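(* Let $q>2$ be a prime power and $\nu\ge 1$ an integer. Regard $PSp_{2\nu}(\mathbb{F}_q)$ as a subgroup of $\mathrm{Aut}(Sp(2\nu,q))$, namely as the subgroup $\{\sigma_T : T\in Sp_{2\nu}(\mathbb{F}_q)\}$, and let $E$ be the subgroup $$E=\{\sigma\in \mathrm{Aut}(Sp(2\nu,q)):\ \sigma([e_i])=[e_i],\ \sigma([f_i])=[f_i],\ i=1,\ldots,\nu\}.$$ Then: (1) $\mathrm{Aut}(Sp(2\nu,q))=PSp_{2\nu}(\mathbb{F}_q)\cdot E$, i.e. every automorphism is a product of an element of $PSp_{2\nu}(\mathbb{F}_q)$ and an element of $E$; (2) if $\nu=1$, then $E$ is isomorphic to the symmetric group on $q-1$ elements; (3) if $\nu>1$, then $$E\cong \underbrace{(\mathbb{F}_q^*\times\cdots\times\mathbb{F}_q^* )}_{\nu}\rtimes_{\varphi}\mathrm{Aut}(\mathbb{F}_q).$$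
   Context: Let $\mathbb{F}_q$ be the finite field with $q$ elements, $\mathbb{F}_q^*=\mathbb{F}_q\setminus\{0\}$, and let $\mathbb{F}_q^{(2\nu)}$ be the $2\nu$-dimensional space of row vectors over $\mathbb{F}_q$. Let $K$ be the $2\nu\times 2\nu$ block diagonal matrix over $\mathbb{F}_q$ with $\nu$ diagonal blocks all equal to $\begin{pmatrix}0&1\\-1&0\end{pmatrix}$. For a nonzero row vector $\alpha$, $[\alpha]$ denotes the one-dimensional subspace spanned by $\alpha$. The symplectic graph $Sp(2\nu,q)$ is the simple undirected graph whose vertices are the one-dimensional subspaces of $\mathbb{F}_q^{(2\nu)}$, with $[\alpha]$ adjacent to $[\beta]$ if and only if $\alpha K\,{}^t\!\beta\neq 0$ (where ${}^t\!\beta$ is the transpose of $\beta$). $\mathrm{Aut}(Sp(2\nu,q))$ is its group of graph automorphisms. The vectors $e_1,f_1,e_2,f_2,\ldots,e_\nu,f_\nu$ are, in this order, the standard basis vectors of $\mathbb{F}_q^{(2\nu)}$ (so $e_i$ has a $1$ in position $2i-1$ and $f_i$ has a $1$ in position $2i$, zeros elsewhere). The symplectic group $Sp_{2\nu}(\mathbb{F}_q)$ is the group of $2\nu\times2\nu$ matrices $T$ over $\mathbb{F}_q$ with $TK\,{}^tT=K$. The projective symplectic group $PSp_{2\nu}(\mathbb{F}_q)$ is the quotient of $Sp_{2\nu}(\mathbb{F}_q)$ by the subgroup $\{I,-I\}$, where $I$ is the identity matrix. Each $T\in Sp_{2\nu}(\mathbb{F}_q)$ induces the graph automorphism $\sigma_T:[\alpha]\mapsto[\alpha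 T]$, and two matrices of $Sp_{2\nu}(\mathbb{F}_q)$ induce the same automorphism iff they are scalar multiples of each other, which is how $PSp_{2\nu}(\mathbb{F}_q)$ is regarded as a subgroup of $\mathrm{Aut}(Sp(2\nu,q))$. $\mathrm{Aut}(\mathbb{F}_q)$ is the group of field automorphisms of $\mathbb{F}_q$, and $\varphi$ is its natural action on $\mathbb{F}_q^*\times\cdots\times\mathbb{F}_q^*$ ($\nu$ factors), $\varphi(\pi)((k_1,\ldots,k_\nu))=(\pi(k_1),\ldots,\pi(k_\nu))$. The semidirect product $(\mathbb{F}_q^*\times\cdots\times\mathbb{F}_q^* )\rtimes_\varphi\mathrm{Aut}(\mathbb{F}_q)$ consists of the elements $(k_1,\ldots,k_\nu,\pi)$ with $k_i\in\mathbb{F}_q^*$, $\pi\in\mathrm{Aut}(\mathbb{F}_q)$, with multiplication $$(k_1,\ldots,k_\nu,\pi)(k_1',\ldots,k_\nu',\pi')=(k_1\pi(k_1'),\ldots,k_\nu\pi(k_\nu'),\pi\pi').$$ *)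

(* Defs.v *)
From HB Require Import structures.
From mathcomp Require Import all_boot all_order all_fingroup all_algebra.

Set Implicit Arguments.
Unset Strict Implicit.
Unset Printing Implicit Defensive.

Import GRing.Theory.
Local Open Scope ring_scope.

(* mathcomp only equips {vspace vT} with a choiceType structure. *)
HB.instance Definition _ (F : finFieldType) (vT : vectType F) :
    isCountable {vspace vT} :=
  CanIsCountable (@VectorInternalTheory.vs2mxK F vT).
HB.instance Definition _ (F : finFieldType) (vT : vectType F) :
    isFinite {vspace vT} :=
  CanIsFinite (@VectorInternalTheory.vs2mxK F vT).

Section GraphAut.
Variables (V : finType) (adj : rel V).

Definition graph_aut_set : {set {perm V}} :=
  [set s : {perm V} | [forall x, forall y, adj (s x) (s y) == adj x y]].

Lemma graph_autP (s : {perm V}) :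
  reflect (forall x y, adj (s x) (s y) = adj x y) (s \in graph_aut_set).
Proof.
rewrite inE; apply: (iffP forallP) => [h x y|h x].
  by apply/eqP; apply: (forallP (h x)).
by apply/forallP => y; rewrite h.
Qed.

Lemma graph_aut_group_set : group_set graph_aut_set.
Proof.
apply/group_setP; split; first by apply/graph_autP => x y; rewrite !perm1.
move=> s t /graph_autP hs /graph_autP ht; apply/graph_autP => x y.
by rewrite !permM ht hs.
Qed.

Canonical graph_aut : {group {perm V}} := Group graph_aut_group_set.

End GraphAut.

Section Symplectic.
Variables (F : finFieldType) (nu : nat).
Local Notation n := nu.*2.

(* With 0-based indices, e_i and f_i sit in positions 2i and 2i+1, so the
   nonzero entries are 1 at (2i, 2i+1) and -1 at (2i+1, 2i). *)
Definition symp_form : 'M[F]_n :=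
  \matrix_(i, j) (if ~~ odd i && (j == i.+1 :> nat) then 1
                  else if odd i && (i == j.+1 :> nat) then -1 else 0).
Local Notation K := symp_form.

Inductive vertex : predArgType :=
  Vertex (U : {vspace 'rV[F]_n}) of \dim U == 1%N.

Coercion vertex_space (x : vertex) := let: Vertex U _ := x in U.

HB.instance Definition _ := [isSub for vertex_space].
HB.instance Definition _ := [Finite of vertex by <:].

Fact dim_point (a : 'rV[F]_n) : a != 0 -> \dim <[a]>%VS == 1%N.
Proof. by move=> a0; rewrite dim_vline a0. Qed.

Definition point (a : 'rV[F]_n) (a0 : a != 0) : vertex :=
  Vertex (dim_point a0).

Definition adj : rel vertex := fun x y =>
  [exists a : 'rV[F]_n, exists b : 'rV[F]_n,
    [&& x == <[a]>%VS :> {vspace _}, y == <[b]>%VS :> {vspace _}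
      & a *m K *m b^T != 0]].

Lemma pointP (x : vertex) : exists a, exists a0 : a != 0, x = point a0.
Proof.
case: x => U dU; have U0 : U != 0%VS by rewrite -dimv_eq0 (eqP dU).
have a0 : vpick U != 0 by rewrite vpick0.
exists (vpick U), a0; apply: val_inj => /=.
apply/esym/eqP; rewrite eqEdim -memvE memv_pick dim_vline a0.
by rewrite (eqP dU).
Qed.

Lemma vline_eq (a b : 'rV[F]_n) : a != 0 -> <[a]>%VS = <[b]>%VS ->
  exists2 c : F, c != 0 & a = c *: b.
Proof.
move=> a0 eab; have: a \in <[b]>%VS by rewrite -eab memv_line.
case/vlineP => c ac; exists c => //.
by apply: contraNneq a0 => c0; rewrite ac c0 scale0r.
Qed.

Lemma adjE (a b : 'rV[F]_n) (a0 : a != 0) (b0 : b != 0) :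
  adj (point a0) (point b0) = (a *m K *m b^T != 0).
Proof.
apply/existsP/idP => [[a' /existsP[b' /and3P[/eqP /= ea /eqP /= eb]]]|h].
  have [c c0 ->] := vline_eq a0 ea; have [d d0 ->] := vline_eq b0 eb.
  move=> h; rewrite linearZ -scalemxAl -scalemxAr -scalemxAl !scaler_eq0.
  by rewrite (negPf c0) (negPf d0).
by exists a; apply/existsP; exists b; rewrite /= !eqxx.
Qed.

Fact partner_subproof (i : 'I_n) : ((if odd i then i.-1 else i.+1) < n)%N.
Proof.
have := ltn_ord i; case: ifP => oi lti; first exact: leq_ltn_trans (leq_pred _) lti.
rewrite ltn_neqAle lti andbT; apply: contraFneq oi => ei.
by rewrite -[odd i]negbK -oddS ei odd_double.
Qed.

Definition partner (i : 'I_n) : 'I_n := Ordinal (partner_subproof i).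

Lemma odd_partner i : odd (partner i) = ~~ odd i.
Proof.
rewrite /=; case: ifP => oi; last by rewrite /= oi.
by case: (val i) oi => //= m /negbTE.
Qed.

Lemma partnerK : involutive partner.
Proof.
move=> i; apply: val_inj; rewrite /= -/(val (partner i)).
have := odd_partner i; rewrite /=; case: ifP => oi -> //=.
by rewrite prednK //; case: (val i) oi.
Qed.

Lemma symp_formE i j : K i j = (-1) ^+ odd i * (j == partner i)%:R.
Proof.
rewrite mxE -val_eqE /=; case: (boolP (odd i)) => oi /=.
  have i_gt0 : (0 < i)%N by case: (val i) oi.
  rewrite -[X in X == j.+1](prednK i_gt0) eqSS eq_sym.
  by case: eqP; rewrite ?mulr0 ?mulr1.
by case: eqP; rewrite ?mulr0 ?mulr1.
Qed.

Lemma trmx_symp_form : K^T = - K.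
Proof.
apply/matrixP => i j.
rewrite [LHS]mxE [RHS]mxE [in LHS]symp_formE [in RHS]symp_formE.
rewrite -(inj_eq (can_inj partnerK)) partnerK eq_sym.
case: eqP => [->|_]; last by rewrite !mulr0 oppr0.
by rewrite odd_partner; case: odd; rewrite !mulr1 ?opprK.
Qed.

Lemma symp_formK : K *m K = - 1%:M.
Proof.
apply/matrixP => i j; rewrite !mxE (bigD1 (partner i)) //= big1 => [|k ki].
  rewrite !symp_formE eqxx partnerK odd_partner addr0 mulr1 mulrA -signr_addb.
  by case: odd; rewrite mulN1r eq_sym.
by rewrite symp_formE (negPf ki) mulr0 mul0r.
Qed.

Lemma form_alt (a : 'rV[F]_n) : a *m K *m a^T = 0.
Proof.
have E i j : (a *m K *m a^T) i j =
    \sum_(k < n) (-1) ^+ odd k * (a 0 k * a 0 (partner k)).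
  rewrite !ord1 mxE (eq_bigr (fun k : 'I_n => \sum_(l < n) (a 0 l * K l k) * a 0 k)).
    rewrite exchange_big /=; apply: eq_bigr => k _.
    rewrite (bigD1 (partner k)) //= big1 => [|l lk].
      by rewrite symp_formE eqxx mulr1 addr0 mulrCA mulrA.
    by rewrite symp_formE (negPf lk) !mulr0 mul0r.
  by move=> k _; rewrite !mxE mulr_suml.
apply/matrixP => i j; rewrite E mxE (bigID (fun k : 'I_n => odd k)) /=.
rewrite [X in _ + X](reindex_inj (can_inj partnerK)) /=.
rewrite [X in _ + X](eq_bigl (fun k : 'I_n => odd k)); last first.
  by move=> k; rewrite -/(val (partner k)) odd_partner negbK.
rewrite -big_split big1 //= => k ok.
rewrite -/(val (partner k)) odd_partner ok partnerK expr1 mulN1r mul1r.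
by rewrite [X in _ + X]mulrC addNr.
Qed.

Lemma adj_irr : irreflexive adj.
Proof. by move=> x; have [a [a0 ->]] := pointP x; rewrite adjE form_alt eqxx. Qed.

Lemma adj_sym : symmetric adj.
Proof.
move=> x y; have [a [a0 ->]] := pointP x; have [b [b0 ->]] := pointP y.
rewrite !adjE -[in LHS]trmx_eq0 !trmx_mul trmxK trmx_symp_form mulNmx mulmxN.
by rewrite oppr_eq0 mulmxA.
Qed.

Inductive Sp : predArgType :=
  MkSp (T : 'M[F]_n) of T *m K *m T^T == K.

Coercion Sp_mx (g : Sp) := let: MkSp T _ := g in T.

HB.instance Definition _ := [isSub for Sp_mx].
HB.instance Definition _ := [Finite of Sp by <:].

Lemma SpP (g : Sp) : g *m K *m (g : 'M_n)^T = K.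
Proof. by case: g => T /= /eqP. Qed.

Lemma Sp_unit (g : Sp) : (g : 'M_n) \in unitmx.
Proof.
suff: g *m (- (K *m (g : 'M_n)^T *m K)) = 1%:M by case/mulmx1_unit.
by rewrite mulmxN !mulmxA SpP symp_formK opprK.
Qed.

Fact Sp_one_subproof : 1%:M *m K *m (1%:M)^T == K.
Proof. by rewrite trmx1 mulmx1 mul1mx. Qed.

Fact Sp_mul_subproof (g h : Sp) : (g *m h) *m K *m (g *m h)^T == K.
Proof.
rewrite trmx_mul -!mulmxA (mulmxA K) (mulmxA (h : 'M_n)) (mulmxA (h : 'M_n)).
by rewrite SpP mulmxA SpP.
Qed.

Fact Sp_inv_subproof (g : Sp) : invmx g *m K *m (invmx g)^T == K.
Proof.
rewrite -[in X in _ *m X *m _](SpP g) -!mulmxA -trmx_mul mulVmx ?Sp_unit //.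
by rewrite trmx1 mulmx1 mulKmx ?Sp_unit.
Qed.

Definition Sp_one := MkSp Sp_one_subproof.
Definition Sp_mul (g h : Sp) := MkSp (Sp_mul_subproof g h).
Definition Sp_inv (g : Sp) := MkSp (Sp_inv_subproof g).

Fact Sp_mulA : associative Sp_mul.
Proof. by move=> g h k; apply: val_inj; rewrite /= mulmxA. Qed.
Fact Sp_mul1 : left_id Sp_one Sp_mul.
Proof. by move=> g; apply: val_inj; rewrite /= mul1mx. Qed.
Fact Sp_mulV : left_inverse Sp_one Sp_inv Sp_mul.
Proof. by move=> g; apply: val_inj; rewrite /= mulVmx ?Sp_unit. Qed.

HB.instance Definition _ := Finite_isGroup.Build Sp Sp_mulA Sp_mul1 Sp_mulV.

Fact Sp_opp_subproof (g : Sp) : (- (g : 'M_n)) *m K *m (- (g : 'M_n))^T == K.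
Proof. by rewrite linearN /= mulmxN !mulNmx opprK SpP. Qed.
Definition Sp_opp (g : Sp) : Sp := MkSp (Sp_opp_subproof g).

Definition pmI_set : {set Sp} := [set 1%g; Sp_opp 1%g].
Fact pmI_group_set : group_set pmI_set.
Proof.
apply/group_setP; split; first by rewrite !inE eqxx.
have NN : (Sp_opp 1 * Sp_opp 1 = 1)%g.
  by apply: val_inj; rewrite /= mulmxN mulNmx opprK mulmx1.
move=> g h; rewrite !inE => /pred2P[]-> /pred2P[]->;
  by rewrite ?mul1g ?mulg1 ?NN eqxx ?orbT.
Qed.
Canonical pmI : {group Sp} := Group pmI_group_set.

Fact sigma_dim_subproof (g : Sp) (x : vertex) :
  \dim (linfun (mulmxr (g : 'M_n)) @: x)%VS == 1%N.
Proof.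
have [a [a0 ->]] := pointP x; rewrite limg_line lfunE /=.
apply: dim_point; apply: contraNneq a0 => ag0.
by rewrite -[a](mulmxK (Sp_unit g)) ag0 mul0mx.
Qed.

Definition sigma_fun (g : Sp) (x : vertex) : vertex :=
  Vertex (sigma_dim_subproof g x).

Lemma sigma_funM g h x : sigma_fun (g * h)%g x = sigma_fun h (sigma_fun g x).
Proof.
apply: val_inj; have [a [a0 ->]] := pointP x.
by rewrite /= !limg_line !lfunE /= mulmxA.
Qed.

Lemma sigma_fun1 x : sigma_fun 1%g x = x.
Proof.
apply: val_inj; have [a [a0 ->]] := pointP x.
by rewrite /= limg_line lfunE /= mulmx1.
Qed.

Fact sigma_inj (g : Sp) : injective (sigma_fun g).
Proof.
apply: (can_inj (g := sigma_fun g^-1%g)) => x.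
by rewrite -sigma_funM mulgV sigma_fun1.
Qed.

Definition sigma (g : Sp) : {perm vertex} := perm (@sigma_inj g).

Lemma sigmaE (g : Sp) (a : 'rV[F]_n) (a0 : a != 0) (ag0 : a *m g != 0) :
  sigma g (point a0) = point ag0.
Proof. by apply: val_inj; rewrite permE /= limg_line lfunE. Qed.

Fact sigmaM : {in [set: Sp] &, {morph sigma : g h / (g * h)%g}}.
Proof. by move=> g h _ _; apply/permP => x; rewrite permM !permE sigma_funM. Qed.

Canonical sigma_morphism := Morphism sigmaM.

(* The image of Sp in the permutations of the vertices; PSp_isog identifies it
   with the quotient of Sp by {I, -I}. *)
Definition PSp : {group {perm vertex}} := (sigma @* [set: Sp])%G.

Lemma mulSp_neq0 (g : Sp) (a : 'rV[F]_n) : a != 0 -> a *m g != 0.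
Proof.
by apply: contraNneq => ag0; rewrite -[a](mulmxK (Sp_unit g)) ag0 mul0mx.
Qed.

Lemma PSp_sub_aut : PSp \subset graph_aut adj.
Proof.
apply/subsetP => _ /morphimP[g _ _ ->]; apply/graph_autP => x y.
have [a [a0 ->]] := pointP x; have [b [b0 ->]] := pointP y.
rewrite !(sigmaE _ (mulSp_neq0 g _)) !adjE trmx_mul.
by rewrite -!mulmxA (mulmxA K) (mulmxA (g : 'M_n)) (mulmxA (g : 'M_n)) SpP mulmxA.
Qed.

Lemma sigma_eq1 (g : Sp) : sigma g = 1%g -> exists c : F, g = c%:M :> 'M_n.
Proof.
move=> sg1; have H (a : 'rV[F]_n) : exists c, a *m g = c *: a.
  have [->|a0] := eqVneq a 0; first by exists 0; rewrite mul0mx scaler0.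
  have ag0 := mulSp_neq0 g a0.
  have /(congr1 vertex_space)/= := sigmaE a0 ag0; rewrite sg1 perm1 /= => e.
  by have [c _ ->] := vline_eq ag0 (esym e); exists c.
have gE i j : i != j -> g i j = 0.
  move=> ij; have [c] := H (delta_mx 0 i); rewrite -rowE => /rowP/(_ j).
  by rewrite !mxE eqxx eq_sym (negPf ij) mulr0.
have gD i j : g i i = g j j.
  have [->//|ij] := eqVneq i j.
  have [c] := H (delta_mx 0 i + delta_mx 0 j); rewrite mulmxDl -!rowE => /rowP e.
  have ji : j != i by rewrite eq_sym.
  have := e i; rewrite !mxE !eqxx (gE j i) // (negPf ij) !addr0 mulr1 => ->.
  have := e j; rewrite !mxE !eqxx (gE i j) // (negPf ji) !add0r mulr1.
  by move=> ->.
case: (posnP n) => [n0|n_gt0].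
  by exists 0; apply/matrixP => -[i lti]; exfalso; rewrite n0 in lti.
exists (g (Ordinal n_gt0) (Ordinal n_gt0)); apply/matrixP => i j.
rewrite [in RHS]mxE; have [<-|ij] := eqVneq i j; first by rewrite mulr1n; exact: gD.
by rewrite mulr0n gE.
Qed.

Lemma ker_sigma : ('ker sigma)%g = pmI.
Proof.
apply/setP => g; rewrite !inE /=; apply/eqP/pred2P => [sg1|[]->]; last first.
- apply/permP => x; have [a [a0 ->]] := pointP x.
  rewrite (sigmaE _ (mulSp_neq0 _ a0)) perm1; apply: val_inj => /=.
  rewrite mulmxN mulmx1; apply/eqP; rewrite eqEdim -memvE.
  by rewrite memvN memv_line !dim_vline oppr_eq0 leqnn.
- by apply/permP => x; rewrite permE perm1 sigma_fun1.
have [c gc] := sigma_eq1 sg1.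
case: (posnP n) => [n0|n_gt0].
  by left; apply: val_inj; apply/matrixP => -[i lti]; exfalso; rewrite n0 in lti.
have /(congr1 (fun M => M *m (- K)))/matrixP/(_ (Ordinal n_gt0) (Ordinal n_gt0)) := SpP g.
rewrite gc tr_scalar_mx mul_scalar_mx mul_mx_scalar scalerA -scalemxAl.
rewrite !mulmxN symp_formK opprK !mxE eqxx mulr1 => /eqP.
rewrite -expr2 -subr_eq0 subr_sqr_1 mulf_eq0 subr_eq0 addr_eq0.
case/pred2P => c1; [left|right]; apply: val_inj; rewrite /= gc c1 //.
by rewrite raddfN.
Qed.

Lemma PSp_isog : ([set: Sp] / pmI)%g \isog PSp.
Proof. by rewrite -ker_sigma; exact: first_isog. Qed.

Fact e_idx_subproof (i : 'I_nu) : (i.*2 < n)%N.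
Proof. by rewrite ltn_double. Qed.
Fact f_idx_subproof (i : 'I_nu) : (i.*2.+1 < n)%N.
Proof. by rewrite ltn_Sdouble. Qed.

Definition e_ (i : 'I_nu) : 'rV[F]_n := delta_mx 0 (Ordinal (e_idx_subproof i)).
Definition f_ (i : 'I_nu) : 'rV[F]_n := delta_mx 0 (Ordinal (f_idx_subproof i)).

Fact delta_neq0 (j : 'I_n) : delta_mx 0 j != 0 :> 'rV[F]_n.
Proof.
by apply/eqP => /rowP/(_ j)/eqP; rewrite !mxE !eqxx oner_eq0.
Qed.

Definition e_point (i : 'I_nu) : vertex := point (delta_neq0 _ : e_ i != 0).
Definition f_point (i : 'I_nu) : vertex := point (delta_neq0 _ : f_ i != 0).

Definition E_set : {set {perm vertex}} :=
  [set s in graph_aut adj |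
    [forall i : 'I_nu,
      (s (e_point i) == e_point i) && (s (f_point i) == f_point i)]].

Lemma E_P (s : {perm vertex}) :
  reflect [/\ s \in graph_aut adj, forall i, s (e_point i) = e_point i
            & forall i, s (f_point i) = f_point i] (s \in E_set).
Proof.
rewrite [s \in E_set]in_set; apply: (iffP andP) => [[sA /forallP h]|[sA he hf]].
  by split=> // i; have /andP[/eqP ? /eqP ?] := h i.
by split=> //; apply/forallP => i; rewrite he hf !eqxx.
Qed.

Fact E_group_set : group_set E_set.
Proof.
apply/group_setP; split; first by apply/E_P; split=> [|i|i]; rewrite ?group1 ?perm1.
move=> s t /E_P[As es fs] /E_P[At et ft].
by apply/E_P; split=> [|i|i]; rewrite ?groupM // permM ?es ?fs.
Qed.

Canonical E : {group {perm vertex}} := Group E_group_set.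

End Symplectic.

Section FieldAut.
Variable F : finFieldType.

Definition field_aut_set : {set {perm F}} :=
  [set s : {perm F} | [&& s 1 == 1,
     [forall x, forall y, s (x + y) == s x + s y] &
     [forall x, forall y, s (x * y) == s x * s y]]].

Lemma field_autP (s : {perm F}) :
  reflect [/\ s 1 = 1, {morph s : x y / x + y} & {morph s : x y / x * y}]
          (s \in field_aut_set).
Proof.
rewrite inE; apply: (iffP and3P) => -[s1 sD sM]; split.
- exact/eqP.
- by move=> x y; apply/eqP/(forallP (forallP sD x)).
- by move=> x y; apply/eqP/(forallP (forallP sM x)).
- exact/eqP.
- by apply/forallP => x; apply/forallP => y; apply/eqP.
- by apply/forallP => x; apply/forallP => y; apply/eqP.
Qed.

Fact field_aut_group_set : group_set field_aut_set.
Proof.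
apply/group_setP; split.
  by apply/field_autP; split=> [|x y|x y]; rewrite !perm1.
move=> s t /field_autP[s1 sD sM] /field_autP[t1 tD tM].
by apply/field_autP; split=> [|x y|x y]; rewrite !permM ?s1 ?sD ?sM.
Qed.

Canonical field_aut : {group {perm F}} := Group field_aut_group_set.

Lemma field_aut_eq0 (s : {perm F}) x : s \in field_aut -> (s x == 0) = (x == 0).
Proof.
case/field_autP => _ sD _; have s0 : s 0 = 0.
  by apply: (addrI (s 0)); rewrite -sD !addr0.
by rewrite -[in LHS]s0 (inj_eq perm_inj).
Qed.

End FieldAut.

Section SemiDirect.
Variables (F : finFieldType) (nu : nat).

Inductive semidirect : predArgType :=
  SemiDirect (u : {ffun 'I_nu -> F} * {perm F})
    of [forall i, u.1 i != 0] && (u.2 \in field_aut F).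

Coercion sd_pair (u : semidirect) := let: SemiDirect p _ := u in p.

HB.instance Definition _ := [isSub for sd_pair].
HB.instance Definition _ := [Finite of semidirect by <:].

Lemma sd_neq0 (u : semidirect) i : u.1 i != 0.
Proof. by case: u => p /= /andP[/forallP]. Qed.
Lemma sd_aut (u : semidirect) : u.2 \in field_aut F.
Proof. by case: u => p /= /andP[]. Qed.

(* Permutations compose from left to right in mathcomp: pi o pi' is the perm
   (pi' * pi)%g. *)
Definition sd_mul_pair (u v : {ffun 'I_nu -> F} * {perm F}) :=
  ([ffun i => u.1 i * u.2 (v.1 i)], (v.2 * u.2)%g).

Fact sd_one_subproof :
  let u := ([ffun=> 1] : {ffun 'I_nu -> F}, 1%g : {perm F}) in
  [forall i, u.1 i != 0] && (u.2 \in field_aut F).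
Proof. by rewrite /= group1 andbT; apply/forallP => i; rewrite ffunE oner_eq0. Qed.

Fact sd_mul_subproof (u v : semidirect) :
  let w := sd_mul_pair u v in
  [forall i, w.1 i != 0] && (w.2 \in field_aut F).
Proof.
rewrite /= groupM ?sd_aut // andbT; apply/forallP => i.
by rewrite ffunE mulf_eq0 field_aut_eq0 ?sd_aut // negb_or !sd_neq0.
Qed.

Fact sd_inv_subproof (u : semidirect) :
  let w := ([ffun i => (u.2^-1)%g (u.1 i)^-1], (u.2^-1)%g) in
  [forall i, w.1 i != 0] && (w.2 \in field_aut F).
Proof.
rewrite /= groupV sd_aut andbT; apply/forallP => i.
by rewrite ffunE field_aut_eq0 ?groupV ?sd_aut // invr_eq0 sd_neq0.
Qed.

Definition sd_one := SemiDirect sd_one_subproof.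
Definition sd_mul (u v : semidirect) := SemiDirect (sd_mul_subproof u v).
Definition sd_inv (u : semidirect) := SemiDirect (sd_inv_subproof u).

Fact sd_mulA : associative sd_mul.
Proof.
move=> u v w; apply: val_inj; rewrite /= /sd_mul_pair /= mulgA; congr pair.
apply/ffunP => i; rewrite !ffunE permM.
by have /field_autP[_ _ ->] := sd_aut u; rewrite mulrA.
Qed.

Fact sd_mul1 : left_id sd_one sd_mul.
Proof.
move=> u; apply: val_inj; case: u => -[k s] /= _.
rewrite /sd_mul_pair /= mulg1; congr pair.
by apply/ffunP => i; rewrite !ffunE perm1 mul1r.
Qed.

Fact sd_mulV : left_inverse sd_one sd_inv sd_mul.
Proof.
move=> u; apply: val_inj; rewrite /= /sd_mul_pair /= mulgV; congr pair.
have /groupVr/field_autP[s1 _ sM] := sd_aut u.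
by apply/ffunP => i; rewrite !ffunE -sM mulVf ?sd_neq0.
Qed.

HB.instance Definition _ :=
  Finite_isGroup.Build semidirect sd_mulA sd_mul1 sd_mulV.

End SemiDirect.

(* Main.v *)
Require Import Defs.
From mathcomp Require Import all_boot all_order all_fingroup all_algebra.
From mathcomp Require Import ring.

Set Implicit Arguments.
Unset Strict Implicit.
Unset Printing Implicit Defensive.

Import GRing.Theory.
Local Open Scope ring_scope.

(* An automorphism sends the lines of the standard symplectic basis to lines
   spanned by a rescaled symplectic basis, which gives Aut = PSp E.  If nu = 1
   all distinct vertices are adjacent and E permutes the remaining q - 1 points
   arbitrarily.  If nu > 1, an element s of E preserves the proportionality of
   any two coordinates (a_i : a_j), because that is orthogonality to a vector
   supported on the partners of i and j.  So in the chart a_o = 1, o the index of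
   e_1, s acts by a map rho_j on each coordinate j, and orthogonality of
   (1, y + x t, x at e_i) and (1, y, t at f_i) reads
     rho_o'(y + x t) = rho_o'(y) + rho_(e_i)(x) rho_(f_i)(t),   o' the index of f_1,
   which forces all the rho_j to be multiples of a single field automorphism. *)

(** * The scalar symplectic form and images of spanning vectors *)

Section Form.
Variables (F : finFieldType) (nu : nat).
Local Notation n := nu.*2.
Local Notation K := (symp_form F nu).
Implicit Types (a b c : 'rV[F]_n) (i j k : 'I_n) (s : {perm vertex F nu}).

Definition sympl a b : F := (a *m K *m b^T) 0 0.

Lemma mulmx_sympl a b : a *m K *m b^T = (sympl a b)%:M.
Proof. by apply/matrixP => i j; rewrite !ord1 [RHS]mxE eqxx mulr1n. Qed.

Lemma sympl_eq0 a b : (a *m K *m b^T == 0) = (sympl a b == 0).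
Proof.
rewrite mulmx_sympl; apply/eqP/eqP => [/matrixP/(_ 0 0)|->].
  by rewrite !mxE eqxx mulr1n.
by rewrite raddf0.
Qed.

Lemma symplE a b :
  sympl a b = \sum_(k < n) (-1) ^+ odd k * (a 0 k * b 0 (partner k)).
Proof.
rewrite /sympl mxE (eq_bigr (fun k : 'I_n => \sum_(l < n) (a 0 l * K l k) * b 0 k)).
  rewrite exchange_big /=; apply: eq_bigr => k _.
  rewrite (bigD1 (partner k)) //= big1 => [|l lk].
    by rewrite symp_formE eqxx mulr1 addr0 mulrAC [RHS]mulrC.
  by rewrite symp_formE (negPf lk) !mulr0 mul0r.
by move=> k _; rewrite !mxE mulr_suml.
Qed.

Lemma partner_neq k : partner k != k.
Proof.
by apply/eqP => /(congr1 (fun i : 'I_n => odd i)); rewrite odd_partner; case: odd.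
Qed.

Lemma symplC a b : sympl b a = - sympl a b.
Proof.
rewrite !symplE (reindex_inj (can_inj (@partnerK nu))) /= -sumrN.
apply: eq_bigr => k _; rewrite -/(val (partner k)) odd_partner partnerK.
by rewrite signrN mulNr [b _ _ * _]mulrC.
Qed.

Lemma symplZl x a b : sympl (x *: a) b = x * sympl a b.
Proof. by rewrite /sympl -!scalemxAl mxE. Qed.

Lemma symplZr x a b : sympl a (x *: b) = x * sympl a b.
Proof. by rewrite /sympl linearZ -!scalemxAr mxE. Qed.

Lemma sympl_delta a k :
  sympl a (delta_mx 0 k) = - (-1) ^+ odd k * a 0 (partner k).
Proof.
rewrite symplE (bigD1 (partner k)) //= big1 => [|l lk].
  by rewrite -/(val (partner k)) odd_partner partnerK mxE !eqxx mulr1 addr0 signrN.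
rewrite mxE eqxx -(inj_eq (can_inj (@partnerK nu))) partnerK (negPf lk).
by rewrite !mulr0.
Qed.

(** Any spanning vectors are allowed, so that images can be represented by [img], which is
    determined only up to a scalar. *)
Lemma adj_sympl (x y : vertex F nu) a b : x = <[a]>%VS :> {vspace _} ->
  y = <[b]>%VS :> {vspace _} -> adj x y = (sympl a b != 0).
Proof.
have nz (z : vertex F nu) d : z = <[d]>%VS :> {vspace _} -> d != 0.
  by case: z => U /= dU Ud; move: dU; rewrite Ud dim_vline; case: (d != 0).
move=> xa yb; have a0 := nz _ _ xa; have b0 := nz _ _ yb.
have -> : x = point a0 by apply: val_inj.
have -> : y = point b0 by apply: val_inj.
by rewrite adjE sympl_eq0.
Qed.

(* A vector spanning the image of [a]; the junk value at a = 0 is 0. *)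
Definition img s a : 'rV[F]_n :=
  if insub <[a]>%VS is Some x then vpick (vertex_space (s x)) else 0.

Lemma img_point s a (a0 : a != 0) : img s a = vpick (s (point a0)).
Proof. by rewrite /img -[<[a]>%VS]/(val (point a0)) valK. Qed.

Lemma imgE s a (a0 : a != 0) : s (point a0) = <[img s a]>%VS :> {vspace _}.
Proof.
rewrite (img_point s a0); case: (s _) => U /= dU; apply/esym/eqP.
by rewrite eqEdim -memvE memv_pick dim_vline vpick0 -dimv_eq0 (eqP dU).
Qed.

Lemma img_neq0 s a : a != 0 -> img s a != 0.
Proof.
move=> a0; rewrite (img_point s a0); case: (s _) => U /= dU.
by rewrite vpick0 -dimv_eq0 (eqP dU).
Qed.

Lemma perm_point s a (a0 : a != 0) : s (point a0) = point (img_neq0 s a0).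
Proof. by apply: val_inj; rewrite /= imgE. Qed.

Lemma point_eqP a b (a0 : a != 0) (b0 : b != 0) :
  reflect (exists2 x, x != 0 & a = x *: b) (point a0 == point b0).
Proof.
apply: (iffP eqP) => [/(congr1 (@vertex_space _ _))|[x x0 ab]].
  exact: vline_eq.
apply: val_inj; apply/eqP; rewrite eqEdim !dim_vline a0 b0 /= andbT -memvE.
by rewrite ab memvZ ?memv_line.
Qed.

(** Only the vanishing of the form can be compared, since adjacency does not see scalar factors. *)
Lemma sympl_img s a b : s \in graph_aut (@adj F nu) -> a != 0 -> b != 0 ->
  (sympl (img s a) (img s b) == 0) = (sympl a b == 0).
Proof.
move=> /graph_autP As a0 b0; apply: negb_inj.
have := As (point a0) (point b0).
by rewrite (adj_sympl (imgE s a0) (imgE s b0)) => ->; rewrite adjE sympl_eq0.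
Qed.

(** Even indices belong to the e_i and odd ones to the f_i, with i = [j./2]; this lets [mem_E] treat
    both families with one index. *)
Lemma deltaP j : exists i : 'I_nu,
  point (delta_neq0 F j) = e_point F i \/ point (delta_neq0 F j) = f_point F i.
Proof.
have lj : (j./2 < nu)%N by rewrite ltn_half_double.
exists (Ordinal lj); have := odd_double_half j; case: odd => /= ej; [right|left].
  by apply: val_inj => /=; congr (<[delta_mx _ _]>%VS); apply: val_inj => /=.
by apply: val_inj => /=; congr (<[delta_mx _ _]>%VS); apply: val_inj => /=.
Qed.

Lemma mem_E s : (s \in E F nu) =
  (s \in graph_aut (@adj F nu)) &&
  [forall j, s (point (delta_neq0 F j)) == point (delta_neq0 F j)].
Proof.
apply/E_P/andP => [[As es fs]|[As /forallP ds]]; split=> //.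
- by apply/forallP => j; apply/eqP; have [i [->|->]] := deltaP j.
- by move=> i; apply/eqP/ds.
by move=> i; apply/eqP/ds.
Qed.

End Form.

(** * Symplectic frames and the factorisation through [PSp] *)

Section Frame.
Variables (F : finFieldType) (nu : nat).
Local Notation n := nu.*2.
Local Notation K := (symp_form F nu).
Implicit Types (a b c : 'rV[F]_n) (i j k : 'I_n) (s : {perm vertex F nu}).

Lemma sympl_delta2 i j :
  sympl (delta_mx 0 i) (delta_mx 0 j) = K i j.
Proof.
by rewrite sympl_delta mxE eqxx symp_formE -(inj_eq (can_inj (@partnerK nu))) partnerK;
  case: eqP => [->|]; rewrite ?odd_partner ?signrN ?opprK ?mulr0.
Qed.

Lemma symp_form_neq0 i j : (K i j != 0) = (j == partner i).
Proof.
by rewrite symp_formE mulf_eq0 signr_eq0; case: (j =P _); rewrite ?oner_eq0 ?eqxx.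
Qed.

Lemma sympl_rows (T : 'M[F]_n) i j : (T *m K *m T^T) i j = sympl (row i T) (row j T).
Proof. rewrite /sympl -row_mul [LHS]mxE [RHS]mxE; apply: eq_bigr => k _.
by congr (_ * _); rewrite !mxE. Qed.

(* Rescaling one vector of each hyperbolic pair turns the images of the basis
   lines into a symplectic basis. *)
Lemma exists_Sp_frame s : s \in graph_aut (@adj F nu) -> exists g : Sp F nu,
  forall j, sigma g (point (delta_neq0 F j)) = s (point (delta_neq0 F j)).
Proof.
move=> As; pose w j := img s (delta_mx 0 j).
have wE i j : (sympl (w i) (w j) != 0) = (j == partner i).
  by rewrite sympl_img ?delta_neq0 // sympl_delta2 symp_form_neq0.
(* For odd j this factor gives the pair ([partner j], j) the form value 1, the entry of K in an even
   row. *)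
pose x j := if odd j then (sympl (w (partner j)) (w j))^-1 else 1.
have x0 j : x j != 0.
  rewrite /x; case: ifP => _; last exact: oner_neq0.
  by rewrite invr_eq0 wE partnerK.
pose T := \matrix_j (x j *: w j).
have TSp : T *m K *m T^T == K.
  apply/eqP/matrixP => i j; rewrite sympl_rows !rowK symplZl symplZr.
  have [->|ij] := eqVneq j (partner i); last first.
    have /eqP -> : sympl (w i) (w j) == 0 by rewrite -[_ == _]negbK wE.
    rewrite !mulr0; apply/esym/eqP; rewrite -[_ == _]negbK symp_form_neq0.
    by [].
  have nz : sympl (w i) (w (partner i)) != 0 by rewrite wE.
  rewrite symp_formE eqxx mulr1 /x odd_partner; case: odd => /=.
    rewrite mul1r [sympl (w i) _]symplC mulrN mulVf ?expr1 //.
    by rewrite wE partnerK.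
  by rewrite partnerK mul1r expr0 mulVf.
exists (MkSp TSp) => j.
rewrite (sigmaE _ (mulSp_neq0 _ (delta_neq0 F j))) (perm_point s).
apply/eqP/point_eqP; exists (x j) => //=.
by rewrite -rowE rowK.
Qed.

Lemma graph_aut_PSpE : (PSp F nu * E F nu)%g = graph_aut (@adj F nu).
Proof.
have subE : E F nu \subset graph_aut (@adj F nu).
  by apply/subsetP => s; rewrite mem_E => /andP[].
apply/eqP; rewrite eqEsubset mul_subG ?PSp_sub_aut //=.
apply/subsetP => s As.
(* The frame of the inverse is taken: products apply the left factor first, so [sigma g * s] fixes
   every basis line. *)
have [g gE] := exists_Sp_frame (groupVr As).
have Gg : sigma g \in PSp F nu by apply: mem_morphim; rewrite inE.
apply/mulsgP; exists (sigma g)^-1%g (sigma g * s)%g.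
- by rewrite groupV.
- rewrite mem_E groupM //=; last exact: (subsetP (PSp_sub_aut F nu)).
  by apply/forallP => j; rewrite permM gE permKV.
by rewrite mulgA mulVg mul1g.
Qed.

End Frame.

(** * The action of [E] on coordinates *)

Section Coordinates.
Variables (F : finFieldType) (nu : nat).
Local Notation n := nu.*2.
Implicit Types (a b c : 'rV[F]_n) (e i j k : 'I_n) (s : {perm vertex F nu}).

Lemma img_E s j : s \in E F nu ->
  exists2 x, x != 0 & img s (delta_mx 0 j) = x *: delta_mx 0 j.
Proof.
rewrite mem_E => /andP[_ /forallP/(_ j)].
by rewrite (perm_point s) => /point_eqP.
Qed.

Lemma E_graph_aut s : s \in E F nu -> s \in graph_aut (@adj F nu).
Proof. by rewrite mem_E => /andP[]. Qed.

Lemma sympl_delta_eq0 a k : (sympl a (delta_mx 0 k) == 0) = (a 0 (partner k) == 0).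
Proof. by rewrite sympl_delta mulf_eq0 oppr_eq0 signr_eq0. Qed.

(** The coordinate at j vanishes exactly when a is orthogonal to the basis vector at [partner j],
    whose line s fixes. *)
Lemma img_coord_eq0 s a j : s \in E F nu -> a != 0 ->
  (img s a 0 j == 0) = (a 0 j == 0).
Proof.
move=> Es a0; have [x x0 ex] := img_E (partner j) Es.
have := sympl_img (E_graph_aut Es) a0 (delta_neq0 F (partner j)).
rewrite ex symplZr mulf_eq0 (negPf x0) /=.
by rewrite !sympl_delta_eq0 partnerK.
Qed.

Lemma sympl_supp2 a c i j : i != j ->
  (forall k, k \notin [:: partner i; partner j] -> c 0 k = 0) ->
  sympl a c = (-1) ^+ odd i * (a 0 i * c 0 (partner i))
            + (-1) ^+ odd j * (a 0 j * c 0 (partner j)).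
Proof.
move=> ij c0; rewrite symplE (bigD1 i) //= (bigD1 j) /= 1?eq_sym //.
rewrite big1 ?addr0 // => k /andP[ki kj].
by rewrite c0 ?mulr0 // !inE !(inj_eq (can_inj (@partnerK nu))) negb_or ki.
Qed.

(** In a plane, two vectors orthogonal to the nonzero vector (t1 u, t2 v) are proportional. *)
Lemma cross_from_perp (x1 x2 y1 y2 u v t1 t2 : F) : t1 != 0 -> t2 != 0 ->
  t1 * (x1 * u) + t2 * (x2 * v) = 0 -> t1 * (y1 * u) + t2 * (y2 * v) = 0 ->
  (u != 0) || (v != 0) -> x1 * y2 = x2 * y1.
Proof.
move=> t1n t2n ex ey /orP[un|vn]; apply/eqP; rewrite -subr_eq0.
  suff /eqP : t1 * u * (x1 * y2 - x2 * y1) = 0.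
    by rewrite !mulf_eq0 (negPf t1n) (negPf un).
  transitivity ((t1 * (x1 * u) + t2 * (x2 * v)) * y2
              - (t1 * (y1 * u) + t2 * (y2 * v)) * x2).
    by ring.
  by rewrite ex ey; ring.
suff /eqP : t2 * v * (x1 * y2 - x2 * y1) = 0.
  by rewrite !mulf_eq0 (negPf t2n) (negPf vn).
transitivity ((t1 * (y1 * u) + t2 * (y2 * v)) * x1
            - (t1 * (x1 * u) + t2 * (x2 * v)) * y1).
  by ring.
by rewrite ex ey; ring.
Qed.

(* If (a_i, a_j) and (b_i, b_j) are proportional, some nonzero c supported on
   the partners of i and j is orthogonal to both a and b; so is its image, which
   has the same support. *)
Lemma img_cross s a b i j : s \in E F nu -> a != 0 -> b != 0 -> i != j ->
  a 0 i * b 0 j = a 0 j * b 0 i ->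
  img s a 0 i * img s b 0 j = img s a 0 j * img s b 0 i.
Proof.
move=> Es a0 b0 ij eab.
(* If both coordinates of a vanish, the vector c below would be zero; here the image of a vanishes
   at i and j too. *)
have [/andP[/eqP ai /eqP aj]|nz] := boolP ((a 0 i == 0) && (a 0 j == 0)).
  have /eqP -> : img s a 0 i == 0 by rewrite img_coord_eq0 // ai.
  have /eqP -> : img s a 0 j == 0 by rewrite img_coord_eq0 // aj.
  by rewrite !mul0r.
(* The signs cancel those of the form, so that any d pairs with c to d_i a_j - d_j a_i. *)
pose c : 'rV[F]_n := \row_k (if k == partner i then (-1) ^+ odd i * a 0 j else
   if k == partner j then - ((-1) ^+ odd j * a 0 i) else 0).
have pij : partner j != partner i by rewrite (inj_eq (can_inj (@partnerK nu))) eq_sym.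
have ci : c 0 (partner i) = (-1) ^+ odd i * a 0 j by rewrite mxE eqxx.
have cj : c 0 (partner j) = - ((-1) ^+ odd j * a 0 i).
  by rewrite mxE (negPf pij) eqxx.
have cs k : k \notin [:: partner i; partner j] -> c 0 k = 0.
  by rewrite !inE negb_or mxE => /andP[/negPf-> /negPf->].
have c0 : c != 0.
  apply: contraNneq nz => c0; move: ci cj; rewrite c0 !mxE => /esym/eqP + /esym/eqP.
  by rewrite oppr_eq0 !mulf_eq0 !signr_eq0 /= => -> ->.
have ss m : (-1) ^+ m * (-1) ^+ m = 1 :> F by rewrite -expr2 sqrr_sign.
have perp (d : 'rV[F]_n) : d 0 i * a 0 j = d 0 j * a 0 i -> sympl d c = 0.
  move=> ed; rewrite (sympl_supp2 _ ij cs) ci cj.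
  transitivity ((-1) ^+ odd i * (-1) ^+ odd i * (d 0 i * a 0 j)
              - (-1) ^+ odd j * (-1) ^+ odd j * (d 0 j * a 0 i)); first by ring.
  by rewrite !ss ed subrr.
have ac : sympl a c = 0 by rewrite perp // mulrC.
have bc : sympl b c = 0 by rewrite perp // ![b _ _ * _]mulrC eab.
have := sympl_img (E_graph_aut Es) a0 c0; rewrite ac eqxx.
have := sympl_img (E_graph_aut Es) b0 c0; rewrite bc eqxx.
have cs' k : k \notin [:: partner i; partner j] -> img s c 0 k = 0.
  by move=> /cs ck; apply/eqP; rewrite img_coord_eq0 // ck.
have nz' : (img s c 0 (partner i) != 0) || (img s c 0 (partner j) != 0).
  rewrite !img_coord_eq0 // ci cj oppr_eq0 !mulf_eq0 !signr_eq0 /= orbC -negb_and.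
  exact: nz.
rewrite !(sympl_supp2 _ ij cs') => /eqP e1 /eqP e2.
by apply: (cross_from_perp _ _ e2 e1 nz'); rewrite signr_eq0.
Qed.

Definition axis_vec o j (x : F) : 'rV[F]_n := delta_mx 0 o + x *: delta_mx 0 j.

Lemma axis_vec_o o j x : j != o -> axis_vec o j x 0 o = 1.
Proof. by move=> jo; rewrite !mxE !eqxx eq_sym (negPf jo) mulr0 addr0. Qed.

Lemma axis_vec_j o j x : j != o -> axis_vec o j x 0 j = x.
Proof. by move=> jo; rewrite !mxE !eqxx (negPf jo) mulr1 add0r. Qed.

Lemma coord_neq0 a o : a 0 o != 0 -> a != 0.
Proof. by apply: contraNneq => ->; rewrite mxE. Qed.

(* How s acts on the j-th affine coordinate in the chart a_o = 1. *)
Definition coord_map s o j (x : F) : F :=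
  img s (axis_vec o j x) 0 j / img s (axis_vec o j x) 0 o.

Section Chart.
Variables (s : {perm vertex F nu}) (o : 'I_n).
Hypotheses (Es : s \in E F nu) (even_o : ~~ odd o).
Local Notation rho := (coord_map s o).

(** The axis vector with the same ratio of coordinates at j and o is compared with a through
    [img_cross]. *)
Lemma img_coord a j : j != o -> a 0 o != 0 ->
  img s a 0 j = img s a 0 o * rho j (a 0 j / a 0 o).
Proof.
move=> jo ao; set x := a 0 j / a 0 o.
have vo : axis_vec o j x 0 o != 0 by rewrite axis_vec_o ?oner_neq0.
have v0 := coord_neq0 vo; have a0 := coord_neq0 ao.
have oj : o != j by rewrite eq_sym.
have := img_cross Es a0 v0 oj; rewrite axis_vec_o // axis_vec_j // => e.
have {}e := e _; rewrite /coord_map mulrA e ?mulfK //.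
  by rewrite img_coord_eq0.
by rewrite mulr1 /x mulrC divfK.
Qed.

Lemma coord_map0 j : j != o -> rho j 0 = 0.
Proof.
move=> jo; have vo : axis_vec o j 0 0 o != 0 by rewrite axis_vec_o ?oner_neq0.
apply/eqP; rewrite /coord_map mulf_eq0 img_coord_eq0 ?(coord_neq0 vo) //.
by rewrite axis_vec_j // eqxx.
Qed.

Lemma coord_map_eq0 j x : j != o -> (rho j x == 0) = (x == 0).
Proof.
move=> jo; have vo : axis_vec o j x 0 o != 0 by rewrite axis_vec_o ?oner_neq0.
rewrite /coord_map mulf_eq0 invr_eq0 !img_coord_eq0 ?(coord_neq0 vo) //.
by rewrite axis_vec_j // axis_vec_o // oner_eq0 orbF.
Qed.

Lemma sympl_triple a b e : ~~ odd e -> e != o ->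
  (forall k, k \notin [:: o; partner o; partner e] -> b 0 k = 0) ->
  sympl a b = a 0 o * b 0 (partner o) - a 0 (partner o) * b 0 o
            + a 0 e * b 0 (partner e).
Proof.
move=> even_e eo b0; rewrite symplE (bigD1 o) //= (bigD1 (partner o)) /=; last first.
  exact: partner_neq.
rewrite (bigD1 e) /=; last first.
  rewrite eo; apply: contraNneq even_e => ->.
  by rewrite odd_partner.
rewrite big1 ?addr0 => [|k /andP[/andP[ko kpo] ke]].
  rewrite -/(val (partner o)) odd_partner (negPf even_o) (negPf even_e) partnerK.
  by rewrite /= !expr0 !mul1r mulN1r addrA.
rewrite b0 ?mulr0 // !inE !negb_or !(inj_eq (can_inj (@partnerK nu))) ko ke.
by rewrite andbT /= -(inj_eq (can_inj (@partnerK nu))) partnerK kpo.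
Qed.

Lemma coord_map_affine e x y t : ~~ odd e -> e != o ->
  rho (partner o) (y + x * t) =
  rho (partner o) y + rho e x * rho (partner e) t.
Proof.
move=> even_e eo; pose v p z q w : 'rV[F]_n :=
  \row_k (if k == o then 1 else if k == p then z else if k == q then w else 0).
have po := partner_neq o.
have neq_even i k : odd i -> ~~ odd k -> i != k.
  by move=> oi; apply: contraNneq => <-.
have epo : e != partner o by rewrite eq_sym neq_even ?odd_partner.
have peo : partner e != o by rewrite neq_even ?odd_partner.
have pepo : partner e != partner o by rewrite (inj_eq (can_inj (@partnerK nu))).
set a := v (partner o) (y + x * t) e x; set b := v (partner o) y (partner e) t.
have ao : a 0 o = 1 by rewrite mxE eqxx.
have bo : b 0 o = 1 by rewrite mxE eqxx.
have ap : a 0 (partner o) = y + x * t by rewrite mxE (negPf po) eqxx.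
have bp : b 0 (partner o) = y by rewrite mxE (negPf po) eqxx.
have ae : a 0 e = x by rewrite mxE (negPf eo) (negPf epo) eqxx.
have be : b 0 (partner e) = t by rewrite mxE (negPf peo) (negPf pepo) eqxx.
have aon : a 0 o != 0 by rewrite ao oner_neq0.
have bon : b 0 o != 0 by rewrite bo oner_neq0.
have a0 := coord_neq0 aon; have b0 := coord_neq0 bon.
have bs k : k \notin [:: o; partner o; partner e] -> b 0 k = 0.
  by rewrite mxE !inE !negb_or => /and3P[/negPf-> /negPf-> /negPf->].
have bs' k : k \notin [:: o; partner o; partner e] -> img s b 0 k = 0.
  by move=> kb; apply/eqP; rewrite img_coord_eq0 // bs.
have := sympl_img (E_graph_aut Es) a0 b0.
rewrite (sympl_triple _ even_e eo bs) (sympl_triple _ even_e eo bs').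
(* The vectors a and b are orthogonal, since y - (y + x t) + x t = 0. *)
rewrite ao bo ap bp ae be mulr1 mul1r opprD addrA subrr add0r addNr eqxx.
rewrite (img_coord po aon) (img_coord eo aon) (img_coord po bon) (img_coord peo bon).
rewrite ao bo ap bp ae be !divr1.
set ia := img s a 0 o; set ib := img s b 0 o.
have ian : ia != 0 by rewrite img_coord_eq0.
have ibn : ib != 0 by rewrite img_coord_eq0.
set r1 := rho _ y; set r2 := rho _ (y + _); set r3 := rho _ x; set r4 := rho _ t.
(* The unknown scalars of the two images come out as a common nonzero factor. *)
have -> : ia * (ib * r1) - ia * r2 * ib + ia * r3 * (ib * r4) =
  ia * ib * (r1 + r3 * r4 - r2) by ring.
by rewrite !mulf_eq0 (negPf ian) (negPf ibn) subr_eq0 => /eqP.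
Qed.

End Chart.

End Coordinates.

(** * The semidirect product acting by semilinear similitudes *)

Section SemidirectAction.
Variables (F : finFieldType) (nu : nat) (i0 : 'I_nu).
Local Notation n := nu.*2.
Implicit Types (a b : 'rV[F]_n) (i : 'I_nu) (j : 'I_n).
Implicit Types (u v : semidirect F nu) (k : {ffun 'I_nu -> F}).

Definition eidx i : 'I_n := Ordinal (e_idx_subproof i).

Fact half_ord_subproof j : (j./2 < nu)%N.
Proof. by rewrite ltn_half_double. Qed.
Definition half_ord j : 'I_nu := Ordinal (half_ord_subproof j).

Lemma odd_eidx i : odd (eidx i) = false.
Proof. by rewrite /= odd_double. Qed.

Lemma half_eidx i : half_ord (eidx i) = i.
Proof. by apply: val_inj; rewrite /= doubleK. Qed.

Lemma half_partner j : half_ord (partner j) = half_ord j.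
Proof.
apply: val_inj => /=; have := odd_double_half j; case: odd => /= <-.
  by rewrite add1n /= uphalf_double doubleK.
by rewrite add0n uphalf_double doubleK.
Qed.

Lemma eidx_half j : ~~ odd j -> eidx (half_ord j) = j.
Proof. by move=> oj; apply: val_inj; rewrite /= halfK (negPf oj) subn0. Qed.

Lemma partner_eidx_half j : odd j -> partner (eidx (half_ord j)) = j.
Proof.
move=> oj; rewrite -half_partner eidx_half ?partnerK //.
by rewrite odd_partner oj.
Qed.

Lemma eidx_eq i i' : (eidx i == eidx i') = (i == i').
Proof. by rewrite (can_eq half_eidx). Qed.

Lemma half_eq i j : ~~ odd j -> (half_ord j == i) = (j == eidx i).
Proof. by move=> oj; rewrite -[in RHS](eidx_half oj) eidx_eq. Qed.

Lemma half_eq_odd i j : odd j -> (half_ord j == i) = (j == partner (eidx i)).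
Proof.
move=> oj; rewrite -half_partner half_eq ?odd_partner ?oj //.
by rewrite -[RHS](inj_eq (can_inj (@partnerK nu))) partnerK.
Qed.

(* The weights form the diagonal of a similitude of multiplier [k i0], normalised
   to 1 at the index of e_(i0). *)
Definition weight k j : F :=
  if half_ord j == i0 then if odd j then k i0 else 1
  else if odd j then k i0 / k (half_ord j) else k (half_ord j).

Lemma weight_partner k j : (forall i, k i != 0) ->
  weight k j * weight k (partner j) = k i0.
Proof.
move=> k0; rewrite /weight odd_partner half_partner.
case: ifP => _; case: odd => /=; rewrite ?mul1r ?mulr1 //.
  by rewrite divfK.
by rewrite mulrC divfK.
Qed.

Lemma weight_neq0 k j : (forall i, k i != 0) -> weight k j != 0.
Proof.
move=> k0; have := k0 i0; rewrite -(weight_partner j k0).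
by rewrite mulf_eq0 negb_or => /andP[].
Qed.

(** Each weight is 1, some k i or a quotient of two of them, so the twisted product of the k's
    passes to the weights; this makes [sd_map] an action. *)
Lemma weightM u v j :
  weight (u * v)%g.1 j = weight u.1 j * u.2 (weight v.1 j).
Proof.
have /field_autP[u1 _ uM] := sd_aut u.
have uV x : x != 0 -> u.2 x^-1 = (u.2 x)^-1.
  move=> x0; have ux0 : u.2 x != 0 by rewrite field_aut_eq0 ?sd_aut.
  by apply: (mulfI ux0); rewrite -uM !mulfV.
rewrite /weight /= !ffunE; case: ifP => _; case: odd => //=.
  by rewrite mul1r u1.
by rewrite uM uV ?sd_neq0 //; field; rewrite !field_aut_eq0 ?sd_aut ?sd_neq0.
Qed.

Definition sd_map u a : 'rV[F]_n := \row_j (weight u.1 j * u.2 (a 0 j)).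

Lemma sd_mapM u v a : sd_map (u * v)%g a = sd_map u (sd_map v a).
Proof.
apply/rowP => j; rewrite !mxE weightM /= permM.
by have /field_autP[_ _ ->] := sd_aut u; rewrite mulrA.
Qed.

Lemma sd_map1 a : sd_map 1%g a = a.
Proof.
apply/rowP => j; rewrite !mxE /= perm1 /weight !ffunE divr1.
by case: ifP; case: odd; rewrite mul1r.
Qed.

Lemma sd_mapZ u x a : sd_map u (x *: a) = u.2 x *: sd_map u a.
Proof.
apply/rowP => j; rewrite !mxE.
by have /field_autP[_ _ ->] := sd_aut u; rewrite mulrCA.
Qed.

Lemma sd_map_eq0 u a j : (sd_map u a 0 j == 0) = (a 0 j == 0).
Proof.
rewrite mxE mulf_eq0 field_aut_eq0 ?sd_aut // (negPf (weight_neq0 j _)) //.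
exact: sd_neq0.
Qed.

Lemma sd_map_neq0 u a : a != 0 -> sd_map u a != 0.
Proof.
by case/rV0Pn => j aj; apply: (@coord_neq0 _ _ _ j); rewrite sd_map_eq0.
Qed.

(** The weights at j and [partner j] have the constant product [u.1 i0], and a field automorphism
    fixes the signs of the form. *)
Lemma sympl_sd_map u a b :
  sympl (sd_map u a) (sd_map u b) = u.1 i0 * u.2 (sympl a b).
Proof.
have /field_autP[u1 uD uM] := sd_aut u.
have u0 : u.2 0 = 0 by apply/eqP; rewrite field_aut_eq0 ?sd_aut.
have uN x : u.2 (- x) = - u.2 x by apply/eqP; rewrite -addr_eq0 -uD addNr u0.
rewrite !symplE (big_morph _ uD u0) mulr_sumr; apply: eq_bigr => j _.
rewrite !mxE !uM -(weight_partner j (sd_neq0 u)).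
have -> : u.2 ((-1) ^+ odd j) = (-1) ^+ odd j.
  by case: odd; rewrite ?expr1 ?expr0 ?uN u1.
by ring.
Qed.

Lemma vpick_vertex_neq0 (x : vertex F nu) : vpick (vertex_space x) != 0.
Proof. by case: x => U /= dU; rewrite vpick0 -dimv_eq0 (eqP dU). Qed.

Definition sd_fun u (x : vertex F nu) : vertex F nu :=
  point (sd_map_neq0 u (vpick_vertex_neq0 x)).

(** Changing the spanning vector by a scalar x changes its image by [u.2 x], so the choice made by
    [vpick] is harmless. *)
Lemma sd_funE u a (a0 : a != 0) : sd_fun u (point a0) = point (sd_map_neq0 u a0).
Proof.
apply/eqP/point_eqP; have /vlineP[x ax] := memv_pick (vertex_space (point a0)).
exists (u.2 x); last by rewrite ax sd_mapZ.
rewrite field_aut_eq0 ?sd_aut //; apply: contraNneq (vpick_vertex_neq0 (point a0)).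
by move=> x0; rewrite ax x0 scale0r.
Qed.

Lemma sd_funM u v x : sd_fun (u * v)%g x = sd_fun u (sd_fun v x).
Proof.
have [a [a0 ->]] := pointP x; rewrite !sd_funE.
by apply: val_inj; rewrite /= sd_mapM.
Qed.

Lemma sd_fun1 x : sd_fun 1%g x = x.
Proof.
have [a [a0 ->]] := pointP x; rewrite sd_funE.
by apply: val_inj; rewrite /= sd_map1.
Qed.

Fact sd_fun_inj u : injective (sd_fun u).
Proof.
by apply: (can_inj (g := sd_fun u^-1%g)) => x; rewrite -sd_funM mulVg sd_fun1.
Qed.

(* sd_fun composes as functions do, the product of permutations in the opposite
   order: the inverse restores a morphism. *)
Definition sd_perm u : {perm vertex F nu} := (perm (@sd_fun_inj u))^-1%g.

Fact sd_permM : {in [set: semidirect F nu] &, {morph sd_perm : u v / (u * v)%g}}.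
Proof.
move=> u v _ _; rewrite /sd_perm -invMg; congr (_^-1)%g.
by apply/permP => x; rewrite permM !permE sd_funM.
Qed.
Canonical sd_perm_morphism := Morphism sd_permM.

Lemma sd_perm_E u : sd_perm u \in E F nu.
Proof.
rewrite groupV mem_E; apply/andP; split.
  apply/graph_autP => x y; rewrite !permE.
  have [a [a0 ->]] := pointP x; have [b [b0 ->]] := pointP y.
  rewrite !sd_funE !adjE !sympl_eq0 sympl_sd_map mulf_eq0 (negPf (sd_neq0 u i0)).
  by rewrite field_aut_eq0 ?sd_aut.
apply/forallP => j; rewrite permE sd_funE; apply/point_eqP.
exists (weight u.1 j); first exact/weight_neq0/sd_neq0.
have /field_autP[u1 _ _] := sd_aut u.
have u0 : u.2 0 = 0 by apply/eqP; rewrite field_aut_eq0 ?sd_aut.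
apply/rowP => l; rewrite !mxE eqxx.
by have [->|_] := eqVneq l j; rewrite ?u1 ?u0 ?mulr0.
Qed.

(** Axis points in the chart a_o = 1 already determine u. The weight 1 at o forces the scalar to be
    1, hence weight times [u.2 x] is x for all x; taking x = 1 separates the weights from [u.2]. *)
Lemma sd_perm_inj : ('injm sd_perm)%g.
Proof.
apply/subsetP => u; rewrite !inE => /eqP su1; apply/eqP.
have {su1} fu x : sd_fun u x = x.
  have /(congr1 (fun t : {perm vertex F nu} => t x)) := canRL (@invgK _) su1.
  by rewrite invg1 permE perm1.
pose o := eidx i0; have oo : odd o = false := odd_eidx i0.
have w1 : weight u.1 o = 1 by rewrite /weight half_eidx eqxx oo.
have /field_autP[u1 _ _] := sd_aut u.
have wx j x : j != o -> weight u.1 j * u.2 x = x.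
  move=> jo; have vo : axis_vec o j x 0 o != 0 by rewrite axis_vec_o ?oner_neq0.
  have := fu (point (coord_neq0 vo)); rewrite sd_funE.
  move=> /eqP/point_eqP[c _ /rowP e].
  have := e o; rewrite mxE [RHS]mxE axis_vec_o // w1 u1 !mulr1 => c1.
  by have := e j; rewrite mxE [RHS]mxE axis_vec_j // -c1 mul1r.
have po := partner_neq o.
have w j : j != o -> weight u.1 j = 1.
  by move=> jo; have := wx j 1 jo; rewrite u1 mulr1.
have u2 : u.2 = 1%g.
  by apply/permP => x; have := wx _ x po; rewrite w // mul1r perm1.
(* The component [u.1 i0] is the weight at the index of f_(i0), and any other [u.1 i] is the weight
   at that of e_i. *)
have u1' : u.1 = [ffun=> 1].
  apply/ffunP => i; rewrite ffunE; have [->|ii0] := eqVneq i i0.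
    have := w _ po; rewrite /weight half_partner half_eidx eqxx odd_partner oo.
    by [].
  have := w (eidx i); rewrite eidx_eq => /(_ ii0).
  by rewrite /weight half_eidx (negPf ii0) odd_eidx.
by apply: val_inj; rewrite /= -u1' -u2; case: (sd_pair u).
Qed.

End SemidirectAction.

(** * Recovering the weights and the field automorphism when [nu > 1] *)

Section Surjectivity.
Variables (F : finFieldType) (nu : nat) (i0 i1 : 'I_nu).
Local Notation n := nu.*2.
Variable s : {perm vertex F nu}.
Hypotheses (i10 : i1 != i0) (Es : s \in E F nu).
Local Notation o := (eidx i0).
Local Notation rho := (coord_map s o).
Local Notation c := (rho (partner o) 1).
Implicit Types (e j : 'I_n) (x y : F).

Let even_o : ~~ odd o. Proof. by rewrite odd_eidx. Qed.
Let even_e1 : ~~ odd (eidx i1). Proof. by rewrite odd_eidx. Qed.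
Let e1o : eidx i1 != o. Proof. by rewrite eidx_eq. Qed.
Let po : partner o != o. Proof. exact: partner_neq. Qed.

Let partner_even_neq e : ~~ odd e -> partner e != o.
Proof. by move=> ee; apply: contraNneq even_o => <-; rewrite odd_partner. Qed.

Let affine e := @coord_map_affine F nu s o Es even_o e.

(** This is the affine law without translation. Its left side does not involve e, which ties every
    hyperbolic pair to the coordinate [partner o]. *)
Let mul e x y : ~~ odd e -> e != o ->
  rho (partner o) (x * y) = rho e x * rho (partner e) y.
Proof.
by move=> ee eo; have := affine x 0 y ee eo; rewrite coord_map0 // !add0r.
Qed.

Let c0 : c != 0. Proof. by rewrite coord_map_eq0 // oner_neq0. Qed.

(** The coordinate [partner o] is the one on which the affine law has a sum; dividing by c sends 1
    to 1. *)
Definition induced_aut x : F := rho (partner o) x / c.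
Local Notation pi := induced_aut.

(** In the affine law at the pair of i1 with t = 1, the product term is again a value of
    [rho (partner o)] by [mul]. *)
Lemma induced_autD : {morph pi : x y / x + y}.
Proof.
move=> x y; rewrite /pi -mulrDl -[in LHS](mulr1 y); congr (_ / _).
by rewrite (affine _ _ _ even_e1 e1o) -mul // mulr1.
Qed.

Lemma induced_aut1 : pi 1 = 1. Proof. by rewrite /pi divff. Qed.

(** With one argument set to 1, [mul] makes [rho j] a constant multiple of [rho (partner o)], for
    odd and even j alike. *)
Lemma coord_map_induced j x : j != o -> rho j x = rho j 1 * pi x.
Proof.
move=> jo; have [oj|ej] := boolP (odd j); last first.
  have n0 : rho (partner j) 1 != 0.
    by rewrite coord_map_eq0 ?oner_neq0 ?partner_even_neq.
  have := mul x 1 ej jo; have := mul 1 1 ej jo; rewrite !mulr1 /pi => -> ->.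
  by field; rewrite n0 coord_map_eq0 ?oner_neq0.
have [->|jpo] := eqVneq j (partner o); first by rewrite mulrC divfK.
have ee : ~~ odd (partner j) by rewrite odd_partner negbK.
have eo : partner j != o.
  by apply: contraNneq jpo => <-; rewrite partnerK.
have n0 : rho (partner j) 1 != 0 by rewrite coord_map_eq0 ?oner_neq0.
have := mul 1 x ee eo; have := mul 1 1 ee eo; rewrite partnerK !mul1r /pi => -> ->.
by field; rewrite n0 coord_map_eq0 ?oner_neq0.
Qed.

(** Both factors in [mul] are constants times values of pi, and the product of the constants is c,
    by [mul] at (1, 1). *)
Lemma induced_autM : {morph pi : x y / x * y}.
Proof.
move=> x y; rewrite {1}/pi (mul x y even_e1 e1o).
have := mul 1 1 even_e1 e1o; rewrite mulr1 => e.
rewrite (coord_map_induced x e1o).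
rewrite (coord_map_induced y (partner_even_neq even_e1)).
by apply: (mulIf c0); rewrite divfK // e; ring.
Qed.

(** An additive map is injective once its kernel is trivial, and pi vanishes only where
    [rho (partner o)] does. *)
Lemma induced_aut_inj : injective pi.
Proof.
move=> x y exy; apply/eqP; rewrite -subr_eq0.
rewrite -(coord_map_eq0 Es _ po) -(mulIr_eq0 _ (mulIf (invr_neq0 c0))).
rewrite -/(pi _) -(inj_eq (addIr (pi y))) -induced_autD subrK add0r.
by rewrite exy.
Qed.

Definition induced_weights : {ffun 'I_nu -> F} :=
  [ffun i => if i == i0 then c else rho (eidx i) 1].

Fact induced_sd_subproof :
  let u := (induced_weights, perm induced_aut_inj) in
  [forall i, u.1 i != 0] && (u.2 \in field_aut F).
Proof.
rewrite /=; apply/andP; split.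
  apply/forallP => i; rewrite ffunE; case: ifP => [_|/negbT ii]; first exact: c0.
  by rewrite coord_map_eq0 ?oner_neq0 ?eidx_eq.
apply/field_autP; split=> [|x y|x y]; rewrite !permE.
- exact: induced_aut1.
- exact: induced_autD.
- exact: induced_autM.
Qed.

Definition induced_sd : semidirect F nu := SemiDirect induced_sd_subproof.
Local Notation u := induced_sd.

(** Only odd j other than [partner o] need an argument: there the weight is a quotient, evaluated by
    [mul] at (1, 1). *)
Lemma weight_induced j : j != o -> weight i0 u.1 j = rho j 1.
Proof.
move=> jo; rewrite /weight /= !ffunE eqxx.
have [oj|ej] := boolP (odd j); last first.
  by rewrite half_eq // (negPf jo) eidx_half.
rewrite half_eq_odd //; case: eqVneq => [->//|jpo].
have eo : eidx (half_ord j) != o.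
  by apply: contraNneq jpo => <-; rewrite partner_eidx_half.
have ee : ~~ odd (eidx (half_ord j)) by rewrite odd_eidx.
have := mul 1 1 ee eo; rewrite mulr1 partner_eidx_half // => ->.
by rewrite mulrAC mulfV ?mul1r // coord_map_eq0 ?oner_neq0.
Qed.

Lemma weight_induced_o : weight i0 u.1 o = 1.
Proof. by rewrite /weight half_eidx eqxx odd_eidx. Qed.

Lemma img_affine_point (a : 'rV[F]_n) : a 0 o != 0 ->
  exists2 x, x != 0 & img s a = x *: sd_map i0 u a.
Proof.
move=> ao; have pao : pi (a 0 o) != 0.
  by rewrite /pi mulf_neq0 ?invr_eq0 ?coord_map_eq0 ?oner_neq0.
(* The factor is forced by the coordinate o, where the weight is 1. *)
exists (img s a 0 o / pi (a 0 o)).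
  by rewrite mulf_neq0 ?invr_eq0 ?img_coord_eq0 ?(coord_neq0 ao).
apply/rowP => j; rewrite !mxE permE; have [->|jo] := eqVneq j o.
  by rewrite weight_induced_o mul1r divfK.
rewrite weight_induced // (img_coord Es jo ao) (coord_map_induced _ jo).
have -> : pi (a 0 j) = pi (a 0 j / a 0 o) * pi (a 0 o).
  by rewrite -induced_autM divfK.
by field.
Qed.

(** A point with a_o = 0 lies outside the chart. Adding the basis vector at o moves it inside and
    keeps the other coordinates, whose image ratios [img_cross] then carries back. *)
Lemma img_induced (a : 'rV[F]_n) : a != 0 ->
  exists2 x, x != 0 & img s a = x *: sd_map i0 u a.
Proof.
have [ao a0|] := eqVneq (a 0 o) 0; last by move=> ao _; apply: img_affine_point.
have [i ai] := rV0Pn _ a0.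
pose b := a + delta_mx 0 o; have bo : b 0 o = 1 by rewrite !mxE ao !eqxx add0r.
have bE j : j != o -> b 0 j = a 0 j.
  by move=> jo; rewrite !mxE (negPf jo) andbF addr0.
have bon : b 0 o != 0 by rewrite bo oner_neq0.
have b0 := coord_neq0 bon.
have io : i != o by apply: contraNneq ai => ->; rewrite ao.
have [y y0 yE] := img_affine_point bon.
have bi : img s b 0 i != 0 by rewrite img_coord_eq0 // bE.
have ai' : img s a 0 i != 0 by rewrite img_coord_eq0.
(* The quotient makes the images of a and b agree at the pivot i, and y relates the image of b to
   [sd_map]. *)
exists (img s a 0 i / img s b 0 i * y); first by rewrite !mulf_neq0 ?invr_eq0.
apply/rowP => j; have [->|jo] := eqVneq j o.
  rewrite [RHS]mxE; have /eqP-> : sd_map i0 u a 0 o == 0 by rewrite sd_map_eq0 ao.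
  by rewrite mulr0; apply/eqP; rewrite img_coord_eq0 // ao.
have -> : (img s a 0 i / img s b 0 i * y *: sd_map i0 u a) 0 j =
    img s a 0 i / img s b 0 i * img s b 0 j.
  have sdE : sd_map i0 u a 0 j = sd_map i0 u b 0 j by rewrite mxE [RHS]mxE bE.
  have bj : img s b 0 j = y * sd_map i0 u b 0 j by rewrite yE mxE.
  by rewrite bj mxE sdE mulrA.
have [<-|ij] := eqVneq i j; first by rewrite divfK.
have := img_cross Es a0 b0 ij; rewrite !bE // => /(_ (mulrC _ _)) e.
by rewrite mulrAC e mulfK.
Qed.

Lemma induced_sd_perm : s = (sd_perm i0 u)^-1%g.
Proof.
rewrite invgK; apply/permP => x; have [a [a0 ->]] := pointP x.
by rewrite permE sd_funE (perm_point s); apply/eqP/point_eqP/img_induced.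
Qed.

End Surjectivity.

Lemma E_isog_semidirect (F : finFieldType) (nu : nat) : (1 < nu)%N ->
  (E F nu \isog [set: semidirect F nu])%g.
Proof.
move=> nu_gt1; pose i0 : 'I_nu := Ordinal (ltnW nu_gt1).
pose i1 : 'I_nu := Ordinal nu_gt1; have i10 : i1 != i0 by [].
rewrite isog_sym; apply/isogP; exists (@sd_perm_morphism F nu i0).
  exact: sd_perm_inj.
apply/eqP; rewrite eqEsubset; apply/andP; split.
  by apply/subsetP => _ /morphimP[u _ _ ->]; apply: sd_perm_E.
(* Since [induced_sd_perm] presents an element as an inverse, it is applied to the inverse of s. *)
apply/subsetP => s Es; have Es' := groupVr Es.
rewrite -[s]invgK (induced_sd_perm i10 Es') invgK.
by apply: mem_morphim; rewrite inE.
Qed.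

(** * Extending permutations along an injection *)

Section ExtendPerm.
Variables (T V : finType) (f : T -> V).
Hypothesis f_inj : injective f.
Implicit Types (p : {perm T}) (x : V).

Definition extend_fun p x : V :=
  if [pick t | f t == x] is Some t then f (p t) else x.

Lemma extend_fun_in p t : extend_fun p (f t) = f (p t).
Proof.
rewrite /extend_fun; case: pickP => [t' /eqP/f_inj->//|/(_ t)].
by rewrite eqxx.
Qed.

Lemma extend_fun_out p x : x \notin f @: setT -> extend_fun p x = x.
Proof.
rewrite /extend_fun; case: pickP => // t /eqP <-.
by rewrite imset_f ?inE.
Qed.

Lemma extend_funM p p' x :
  extend_fun (p * p')%g x = extend_fun p' (extend_fun p x).
Proof.
have [/imsetP[t _ ->]|xf] := boolP (x \in f @: setT).
  by rewrite !extend_fun_in permM.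
by rewrite !extend_fun_out.
Qed.

Lemma extend_fun1 x : extend_fun 1%g x = x.
Proof.
have [/imsetP[t _ ->]|xf] := boolP (x \in f @: setT).
  by rewrite extend_fun_in perm1.
exact: extend_fun_out.
Qed.

Fact extend_fun_inj p : injective (extend_fun p).
Proof.
by apply: (can_inj (g := extend_fun p^-1%g)) => x; rewrite -extend_funM mulgV extend_fun1.
Qed.

Definition extend_perm p : {perm V} := perm (@extend_fun_inj p).

Fact extend_permM : {in [set: {perm T}] &, {morph extend_perm : p p' / (p * p')%g}}.
Proof. by move=> p p' _ _; apply/permP => x; rewrite permM !permE extend_funM. Qed.
Canonical extend_perm_morphism := Morphism extend_permM.

(** Extensions move only points of the image of f, and the symmetric group on that image has no more
    elements than there are extensions. *)
Lemma isog_Sym_imset (G : {group {perm V}}) :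
  G = Sym (f @: setT) :> {set {perm V}} ->
  ([set: {perm T}] \isog G)%g.
Proof.
move=> GE; have inj : ('injm extend_perm)%g.
  apply/subsetP => p; rewrite !inE => /eqP e; apply/eqP/permP => t.
  have := congr1 (fun s : {perm V} => s (f t)) e.
  by rewrite permE extend_fun_in !perm1 => /f_inj.
apply/isogP; exists (@extend_perm_morphism); first exact: inj.
apply/eqP; rewrite eqEcard card_injm // GE; apply/andP; split.
  apply/subsetP => _ /morphimP[p _ _ ->]; rewrite inE; apply/subsetP => x.
  by rewrite inE permE; apply: contraNT => /extend_fun_out->.
rewrite card_Sym card_imset // -card_Sym subset_leq_card //.
exact: subsetT.
Qed.

End ExtendPerm.

(** * The complete graph on the projective line, [nu = 1] *)

Section ProjectiveLine.
Variable F : finFieldType.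
Local Notation n := (1.*2)%N.
Local Notation o := (eidx (ord0 : 'I_1)).
Local Notation po := (partner o).
Implicit Types (a b : 'rV[F]_n) (s : {perm vertex F 1}).

Lemma ord_line (j : 'I_n) : j = o \/ j = po.
Proof.
have h0 (k : 'I_n) : half_ord k = ord0 by apply: val_inj; case: (half_ord k) => -[].
have [oj|ej] := boolP (odd j); [right|left].
  by rewrite -[LHS]partner_eidx_half // h0.
by rewrite -[LHS]eidx_half // h0.
Qed.

Lemma sympl_line a b : sympl a b = a 0 o * b 0 po - a 0 po * b 0 o.
Proof.
rewrite (@sympl_supp2 _ _ _ _ o po) => [||k]; last first.
- by have [->|->] := ord_line k; rewrite !inE ?eqxx ?partnerK ?eqxx ?orbT.
- by rewrite eq_sym partner_neq.
by rewrite odd_partner odd_eidx partnerK expr0 expr1 mul1r mulN1r.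
Qed.

Lemma row_line a b : a 0 o = b 0 o -> a 0 po = b 0 po -> a = b.
Proof. by move=> ao ap; apply/rowP => j; have [->|->] := ord_line j. Qed.

(** In dimension 2 the form is the determinant, which vanishes only on proportional vectors. *)
Lemma adj_line (x y : vertex F 1) : adj x y = (x != y).
Proof.
have [->|xy] := eqVneq x y; first exact: adj_irr.
have [a [a0 xE]] := pointP x; have [b [b0 yE]] := pointP y.
move: xy; rewrite {x}xE {y}yE adjE sympl_eq0; apply: contraNneq.
rewrite sympl_line => /eqP; rewrite subr_eq0 => /eqP e.
suff [c ac] : exists c, a = c *: b.
  apply/point_eqP; exists c => //.
  by apply: contraNneq a0 => c0; rewrite ac c0 scale0r.
have [bo|bo] := eqVneq (b 0 o) 0.
  have bp : b 0 po != 0.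
    by apply: contraNneq b0 => bp; apply/eqP/row_line; rewrite ?bo ?bp mxE.
  exists (a 0 po / b 0 po); apply: row_line; rewrite mxE ?divfK // bo mulr0.
  by apply: (mulIf bp); rewrite e bo mulr0 mul0r.
exists (a 0 o / b 0 o); apply: row_line; rewrite mxE ?divfK //.
by rewrite mulrAC e mulfK.
Qed.

Lemma graph_aut_line s : s \in graph_aut (@adj F 1).
Proof. by apply/graph_autP => x y; rewrite !adj_line (inj_eq perm_inj). Qed.

(** The points off the two basis lines, by slope; the proof term says that the coordinate at o,
    being 1, is nonzero. *)
Definition line_param (x : {x : F | x != 0}) : vertex F 1 :=
  point (coord_neq0 (eq_ind_r (fun y => y != 0) (oner_neq0 F)
    (axis_vec_o (val x) (partner_neq o)))).

Lemma line_param_inj : injective line_param.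
Proof.
move=> x y /eqP/point_eqP[c _ /rowP e]; apply: val_inj.
have po_o := partner_neq o.
have := e o; rewrite [RHS]mxE !axis_vec_o // mulr1 => c1.
by have := e po; rewrite [RHS]mxE !axis_vec_j // -c1 mul1r.
Qed.

Lemma line_paramP (x : vertex F 1) :
  (x \in line_param @: setT) =
  (x != point (delta_neq0 F o)) && (x != point (delta_neq0 F po)).
Proof.
have po_o := partner_neq o.
apply/imsetP/andP => [[y _ ->]|].
  split; apply/negP => /point_eqP[c c0 /rowP e].
    have := e po; rewrite axis_vec_j // !mxE (negPf po_o) andbF mulr0.
    by apply/eqP/(valP y).
  have := e o; rewrite axis_vec_o // !mxE eq_sym (negPf po_o) andbF mulr0.
  by apply/eqP/oner_neq0.
have [a [a0 ->]] := pointP x => -[xo xp].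
(* There are only two indices, so a vector vanishing at one of them is a multiple of the basis
   vector at the other. *)
have nz j k : j != k -> point a0 != point (delta_neq0 F k) -> a 0 j != 0.
  move=> jk; apply: contraNneq => aj; apply/point_eqP.
  have aE : a = a 0 k *: delta_mx 0 k.
    apply/rowP => l; rewrite !mxE eqxx; have [->|lk] := eqVneq l k.
      by rewrite mulr1.
    rewrite mulr0 -[RHS]aj; congr (a _ _).
    by move: jk lk; case: (ord_line j) (ord_line k) (ord_line l) => -> [] -> [] ->;
      rewrite ?eqxx.
  exists (a 0 k) => //; apply/eqP => ak.
  by have := a0; rewrite aE ak scale0r eqxx.
have ap : a 0 po != 0 := nz _ _ po_o xo.
have ao : a 0 o != 0 by apply: (nz _ po); rewrite // eq_sym.
have q0 : a 0 po / a 0 o != 0 by rewrite mulf_neq0 ?invr_eq0.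
exists (exist (fun y => y != 0) _ q0) => //; apply/eqP/point_eqP; exists (a 0 o) => //.
apply: row_line; rewrite [RHS]mxE.
  by rewrite axis_vec_o // mulr1.
by rewrite axis_vec_j // mulrC divfK.
Qed.

(** In a complete graph every permutation is an automorphism, so the only condition left is to fix
    the two basis points. *)
Lemma E_line : E F 1 = Sym (line_param @: setT) :> {set _}.
Proof.
apply/setP => s; rewrite mem_E graph_aut_line [RHS]inE /=.
apply/forallP/subsetP => [fs x sx|fs j].
  by rewrite line_paramP; apply/andP; split; apply: contraNneq sx => ->; apply: fs.
apply: contraT => /fs; rewrite line_paramP.
by have [->|->] := ord_line j; rewrite eqxx ?andbF.
Qed.

End ProjectiveLine.

Lemma E_line_isog (F : finFieldType) : (E F 1 \isog [set: 'S_(#|F| - 1)])%g.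
Proof.
rewrite isog_sym; pose U : finType := {x : F | x != 0}.
have -> : (#|F| - 1)%N = #|U| by rewrite card_sig subn1 -(cardC1 (0 : F)).
(* The target group permutes ordinals, so the nonzero field elements are numbered by [enum_val];
   this leaves the image of [line_param] unchanged. *)
have g_inj : injective (@line_param F \o @enum_val U predT).
  by apply: inj_comp; [apply: line_param_inj|apply: enum_val_inj].
apply: (isog_Sym_imset g_inj); rewrite E_line; congr Sym.
apply/setP => x; apply/imsetP/imsetP => -[y _ ->].
  by exists (enum_rank y); rewrite //= enum_rankK.
by exists (enum_val y).
Qed.

Theorem theorem3p4 (F : finFieldType) (q nu : nat)
    (cardF : #|F| = q) (q_gt2 : (2 < q)%N) (nu_gt0 : (1 <= nu)%N) :
  [/\ (PSp F nu * E F nu)%g = graph_aut (@adj F nu) :> {set {perm vertex F nu}},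
      nu = 1%N -> (E F nu \isog [set: 'S_(q - 1)])%g
    & (1 < nu)%N -> (E F nu \isog [set: semidirect F nu])%g].
Proof.
split; first exact: graph_aut_PSpE.
  by move=> ->; rewrite -cardF; apply: E_line_isog.
exact: E_isog_semidirect.
Qed.
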